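(* Let $G$ be a finite group and let $P$ be a Sylow $2$-subgroup of $G$. Then $$\sum_{\chi\in \mathrm{Irr}_{2'}(G)}\chi(1)^2\ \ge\ |\mathbf N_G(P):P'|,$$ with equality if and only if $\mathbf N_G(P)$ has a normal complement in $G$.
   Context: $\mathrm{Irr}_{2'}(G)$ is the set of irreducible complex characters of $G$ of odd degree. $P'=[P,P]$ is the derived subgroup of $P$ and $\mathbf N_G(P)$ is the normalizer of $P$ in $G$. A normal complement of a subgroup $H\le G$ is a normal subgroup $K\trianglelefteq G$ with $G=KH$ and $K\cap H=1$. *)

(* Defs.v *)
From HB Require Import structures.
From mathcomp Require Import all_boot all_order all_algebra all_fingroup.
From mathcomp Require Import all_solvable all_field all_character.
Set Implicit Arguments.
Unset Strict Implicit.
Unset Printing Implicit Defensive.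
Import Order.TTheory GroupScope GRing.Theory Num.Theory.
Local Open Scope ring_scope.

(* Degrees 'chi_i 1 are natural numbers (Cnat_irr1) living in algC, so
   Num.truncn recovers the degree exactly. *)
Definition Irr_odd (gT : finGroupType) (G : {group gT}) : {set Iirr G} :=
  [set i | odd (Num.truncn ('chi[G]_i 1%g))].

Definition has_normal_complement (gT : finGroupType) (H G : {group gT}) : Prop :=
  exists2 K : {group gT}, K <| G & K \in [complements to H in G].

(* Main.v *)
Require Import Defs.
From HB Require Import structures.
From mathcomp Require Import all_boot all_order all_algebra all_fingroup.
From mathcomp Require Import all_solvable all_field all_character.
Set Implicit Arguments.
Unset Strict Implicit.
Unset Printing Implicit Defensive.
Import Order.TTheory GroupScope GRing.Theory Num.Theory.
Import FiniteModule.
Local Open Scope ring_scope.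

(** The prime 2 may be replaced by any prime p, and everything below is done for
  a Sylow p-subgroup P of G, with N the normalizer of P and P' its derived
  subgroup. An irreducible character of N has P' in its kernel if and only if
  its degree is prime to p (normal_Sylow_Irr_p', normal_pgroup_der_sub_cfker),
  and the squares of the degrees of these characters add up to |N : P'|;
  so both sides of the inequality are sums of squares.

  Inequality. Decompose the restriction to N of each chi of degree prime to p:
  the left-hand side is the sum over the irreducible theta of N of theta(1) a(theta),
  where a(theta) is the sum of the chi(1) [chi_N, theta] (sum_Irr_p'_Res). If P'
  lies in the kernel of theta, then theta induced to G has degree prime to p, so
  some chi of degree prime to p lies over theta, and
  a(theta) >= chi(1) >= theta(1).

  Equality. Then a(theta) is theta(1) or 0 according to whether P' lies in the
  kernel of theta. It follows that every chi of degree prime to p contains P' in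
  its kernel (Irr_p'_ker_der) and that every theta trivial on P' extends to such
  a chi (extend_Irr_p'). Let K be the intersection of the kernels of all these
  chi, and D that of the kernels of those chi that are trivial on P. Extending
  the characters of N / P' and of N / P gives K :&: N = P' and D :&: N = P. In
  G / K the image of P is therefore abelian, and self-normalizing in D / K. By
  the transfer theorem of Burnside D / K has a normal p-complement Y, on which P
  acts without nontrivial fixed points. A character of degree prime to p
  is trivial on a normal subgroup with this property (fixfree_sub_cfker), and
  those of G / K have trivial common kernel, whence Y = 1, D = K P and, by the
  Frattini argument, G = K N. Finally K always has a normal p-complement X
  (Irr_p'_ker_pnilpotent), so that K = X (K :&: P), G = X N and X :&: N, a
  p'-subgroup of P', is trivial.

  Conversely, if M is a normal complement of N, then P acts on M without
  nontrivial fixed points, so that M, and then also M P', lies in the kernel of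
  every chi of degree prime to p; the sum is thus at most |G : M P'| = |N : P'|. *)

(** * Sums over orbits of p-groups *)

(** Orbits of a p-group other than fixed points have size divisible by p, so an
  invariant function contributes a multiple of p on each of them. *)

Lemma dvdA_sum_fixfree (aT : finGroupType) (rT : finType) (D : {group aT})
    (to : action D rT) (p : nat) (P : {group aT}) (S : {set rT})
    (f : rT -> algC) :
    p.-group P -> [acts P, on S | to] -> S :&: 'Fix_to(P) = set0 ->
    {in P & S, forall a x, f (to x a) = f x} -> {in S, forall x, f x \in Aint} ->
  (p %| \sum_(x in S) f x)%A.
Proof.
move=> pP actS fixS fJ Af.
rewrite (set_partition_big _ (orbit_partition actS)) /=.
apply: rpred_sum => _ /imsetP[x Sx ->].
rewrite (eq_bigr (fun=> f x)) => [|_ /imsetP[a Pa ->]]; last exact: fJ.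
have sPD := acts_dom actS.
have [k oPx]: {k | #|orbit to P x| = (p ^ k)%N}.
  by apply: p_natP; apply: pnat_dvd pP; rewrite card_orbit_in ?dvdn_indexg.
rewrite sumr_const oPx; case: k oPx => [/card_orbit1 fix_x | k _].
  have /setP/(_ x) := fixS; rewrite in_setI Sx in_set0 /= => /negP[].
  by apply/afixP=> a Pa; apply/set1P; rewrite -fix_x mem_orbit.
rewrite expnSr mulrnA -mulr_natr mulrC -eqAmod0.
by rewrite eqAmodMr0 // rpredMn ?Af.
Qed.

(** * Characters of degree prime to p *)

Definition Irr_p' (gT : finGroupType) (p : nat) (G : {group gT}) : {set Iirr G} :=
  [set i | ~~ (p %| 'chi[G]_i 1%g)%C].

Section OneGroup.

Variables (gT : finGroupType) (p : nat).
Implicit Types G H P M N : {group gT}.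

Lemma dvdA_nat (m : nat) : (p %| m%:R)%A = (p %| m)%N.
Proof. by rewrite -eqAmod0 eqAmod0_nat. Qed.

Lemma dvdA_irr1 G i : (p %| 'chi[G]_i 1%g)%A = (p %| 'chi_i 1%g)%C.
Proof. by rewrite irr1_degree dvdA_nat dvdC_nat. Qed.

Lemma Irr_p'_constt G (chi : 'CF(G)) :
    chi \is a character -> ~~ (p %| chi 1%g)%C ->
  exists2 i, i \in Irr_p' p G & i \in irr_constt chi.
Proof.
move=> Nchi p'chi; apply/exists_inP; apply: contraR p'chi.
rewrite negb_exists_in => /forall_inP all_dvd.
rewrite {1}[chi]cfun_sum_constt sum_cfunE rpred_sum // => i chi_i.
rewrite cfunE dvdC_mull ?intr_nat ?Cnat_cfdot_char_irr //.
by apply: contraLR chi_i => p'i; apply: all_dvd; rewrite inE.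
Qed.

(** Inducing from a subgroup of index prime to p keeps the degree prime to p. *)
Lemma Irr_p'_Ind G H j : prime p ->
    H \subset G -> p^'.-nat #|G : H| -> j \in Irr_p' p H ->
  exists2 i, i \in Irr_p' p G & j \in irr_constt ('Res[H] 'chi[G]_i).
Proof.
move=> pr_p sHG p'GH; rewrite inE => p'j.
have [||i p'i] := @Irr_p'_constt G ('Ind[G] 'chi_j).
- by rewrite cfInd_char ?irr_char.
- move: p'j; rewrite cfInd1 // !irr1_degree -natrM !dvdC_nat Euclid_dvdM //.
  by rewrite negb_or -[~~ (p %| #|G : H|)%N]p'natE // p'GH.
by exists i; rewrite // -constt_Ind_Res.
Qed.

(** The sum of chi over M is congruent to chi(1) modulo p, because conjugation by
  P fixes only the identity of M. It is thus nonzero, which makes the trivial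
  character of M a constituent of the restriction of chi. *)
Lemma fixfree_sub_cfker G M P i :
    p.-group P -> P \subset G -> M <| G -> 'C_M(P) = 1%g -> i \in Irr_p' p G ->
  M \subset cfker 'chi[G]_i.
Proof.
move=> pP sPG nsMG regP; rewrite inE; apply: contraR => not_kerM.
have [sMG nMG] := andP nsMG.
have: '['Res[M] 'chi_i, 1] == 0.
  apply: contraR not_kerM; rewrite -irr0 => nz.
  by apply: constt0_Res_cfker; rewrite // irr_consttE.
rewrite cfdotE mulf_eq0 invr_eq0 (negPf (neq0CG M)) /= (big_setD1 1%g) //=.
rewrite cfun11 rmorph1 mulr1 cfResE // addr_eq0 => /eqP Dchi1.
rewrite -dvdA_irr1 Dchi1 rpredN.
rewrite (eq_bigr 'chi_i) => [|x]; last first.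
  by case/setD1P=> _ Mx; rewrite cfun1E Mx rmorph1 mulr1 cfResE.
apply: (@dvdA_sum_fixfree _ _ _ 'J%act p P) => //.
- rewrite astabsJ (subset_trans sPG) // normsD1 //.
- rewrite afixJ; apply/setP=> x; rewrite inE in_setD1 in_set0.
  by rewrite -andbA -in_setI regP in_set1 andNb.
- by move=> a x Pa _; rewrite /= cfunJ ?(subsetP sPG).
by move=> x _; apply: Aint_irr.
Qed.

(** The restriction of chi to P has a constituent of degree prime to p; as degrees
  of characters of P are powers of p, it is linear, hence trivial on P'. *)
Lemma normal_pgroup_der_sub_cfker G P i :
  p.-group P -> P <| G -> i \in Irr_p' p G -> P^`(1)%g \subset cfker 'chi[G]_i.
Proof.
move=> pP nsPG; rewrite inE => p'i; have [sPG nPG] := andP nsPG.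
have [||t p't iPt] := @Irr_p'_constt P ('Res[P] 'chi_i).
- by rewrite cfRes_char ?irr_char.
- by rewrite cfRes1.
have lin_t: 'chi_t \is a linear_char.
  rewrite qualifE /= irr_char /=; move: p't (dvd_irr1_cardG t).
  rewrite inE irr1_degree !dvdC_nat => p't dv_t.
  have [k Dt]: {k | irr_degree (socle_of_Iirr t) = (p ^ k)%N}.
    by apply: p_natP; apply: pnat_dvd dv_t pP.
  by move: p't; rewrite Dt; case: k {Dt} => // k; rewrite expnS dvdn_mulr.
have nsP'G: P^`(1)%g <| G := gFnormal_trans _ nsPG.
apply: constt0_Res_cfker => //.
have sP'P: P^`(1)%g \subset P := der_sub 1 P.
rewrite -(cfResRes _ sP'P sPG).
apply: (constt_Res_trans _ iPt); first by rewrite cfRes_char ?irr_char.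
rewrite cfRes_sub_ker -?lin_irr_der1 // lin_char1 // scale1r.
by rewrite irr_consttE irr0 cfnorm1 oner_eq0.
Qed.

(** By Clifford correspondence the character is induced from the inertia group T
  of a linear character lambda of P. The corresponding character of T restricts
  to a multiple of lambda on P, so that its center contains P and its degree
  divides |T : P|. This is the case of a Sylow subgroup in the theorem of Ito on
  abelian normal subgroups. *)
Lemma normal_Sylow_Irr_p' N P j : prime p ->
    P <| N -> p.-Sylow(N) P -> P^`(1)%g \subset cfker 'chi[N]_j ->
  j \in Irr_p' p N.
Proof.
move=> pr_p nsPN sylP kerj; have [sPN nPN] := andP nsPN.
have [_ _ p'NP] := and3P sylP.
have [t jPt] := constt_cfRes_irr P j.
have lin_t: 'chi_t \is a linear_char.
  rewrite lin_irr_der1; apply: subset_trans (cfker_constt _ jPt).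
    by rewrite cfker_Res ?irr_char // subsetI der_sub.
  by rewrite cfRes_char ?irr_char.
have [irrT _ defInd _ _] := constt_Inertia_bijection t nsPN.
have: j \in irr_constt ('Ind[N] 'chi_t) by rewrite constt_Ind_Res.
rewrite -defInd => /imsetP[s Ts Dj]; have := irrT s Ts.
set T := ('I_N['chi_t])%G in s Ts Dj *; move=> irr_s.
have sPT: P \subset T by apply: sub_Inertia.
have sTN: T \subset N := subsetIl _ _.
have Dj1: 'chi_j 1%g = #|N : T|%:R * 'chi_s 1%g.
  by rewrite Dj cfIirrE // cfInd1.
have sPZ: P \subset 'Z('chi_s)%CF.
  apply/subsetP=> x Px; rewrite irr_cfcenterE ?(subsetP sPT) //.
  have [m m_ge0 Ds]: exists2 m, 0 <= m & 'Res[P] 'chi_s = m *: 'chi_t.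
    exists '['Res[P] 'chi_s, 'chi_t].
      by rewrite natr_ge0 // Cnat_cfdot_char ?cfRes_char ?irr_char.
    rewrite constt_Ind_Res in Ts.
    rewrite {1}(Clifford_Res_sum_cfclass (normal_Inertia _ sPN) Ts).
    by rewrite cfclass_inertia big_seq1.
  have := cfResE 'chi_s sPT Px; rewrite Ds cfunE => <-.
  have := cfRes1 P 'chi_s; rewrite Ds cfunE lin_char1 // mulr1 => <-.
  by rewrite normrM normC_lin_char // mulr1 ger0_norm.
have p'NT: p^'.-nat #|N : T| by apply: pnat_dvd p'NP; apply: indexgS.
have: (p^').-nat #|T : 'Z('chi_s)%CF|.
  by apply: pnat_dvd (p'NP); apply: dvdn_trans (indexgS _ sPZ) (indexSg sPT sTN).
move: (dvd_irr1_index_center s).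
rewrite inE Dj1 irr1_degree -natrM !dvdC_nat => dvs p'Z.
by rewrite -p'natE // pnatM p'NT (pnat_dvd dvs).
Qed.

Lemma sum_irr1_sq_quo G H : H <| G ->
  \sum_(i | H \subset cfker 'chi[G]_i) 'chi_i 1%g ^+ 2 = #|G : H|%:R.
Proof.
move=> nsHG; have [sHG nHG] := andP nsHG.
rewrite -card_quotient // -irr_sum_square.
have norm1 (rT : finGroupType) (K : {group rT}) (i : Iirr K) :
  `|'chi_i 1%g| = 'chi_i 1%g by rewrite ger0_norm ?char1_ge0 ?irr_char.
have := sum_norm_irr_quo (group1 G) nsHG; rewrite morph1.
rewrite (eq_bigr (fun i => 'chi_i 1%g ^+ 2)) => [->|i _]; rewrite ?norm1 //.
by apply: eq_bigr => i _; rewrite norm1.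
Qed.

(** * Restriction to the Sylow normalizer *)

Section Counting.

Variables G P : {group gT}.
Hypotheses (pr_p : prime p) (sylP : p.-Sylow(G) P).

(** The multiplicity of chi_j in the restriction of the part of the regular
  character of G that collects the degrees prime to p. *)
Definition Res_norm_mult (j : Iirr 'N_G(P)) : algC :=
  \sum_(i in Irr_p' p G) 'chi_i 1%g * '['Res['N_G(P)] 'chi_i, 'chi_j].
Local Notation a := Res_norm_mult.

Lemma sum_Irr_p'_Res :
  \sum_(i in Irr_p' p G) 'chi[G]_i 1%g ^+ 2 = \sum_j 'chi_j 1%g * a j.
Proof.
transitivity (\sum_(i in Irr_p' p G)
    \sum_j 'chi_j 1%g * ('chi[G]_i 1%g * '['Res['N_G(P)] 'chi_i, 'chi_j])).
  apply: eq_bigr => i _; rewrite expr2 -{2}(cfRes1 'N_G(P)).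
  rewrite {1}['Res 'chi_i]cfun_sum_cfdot sum_cfunE mulr_sumr.
  by apply: eq_bigr => j _; rewrite cfunE mulrA mulrC.
by rewrite exchange_big /=; apply: eq_bigr => j _; rewrite -mulr_sumr.
Qed.

Lemma Res_norm_mult_ge i j :
    i \in Irr_p' p G -> j \in irr_constt ('Res['N_G(P)] 'chi_i) ->
  'chi_i 1%g <= a j.
Proof.
move=> p'i ij; rewrite /a (bigD1 i) //=.
have ge1: 1 <= '['Res['N_G(P)] 'chi_i, 'chi_j].
  have: '['Res['N_G(P)] 'chi_i, 'chi_j] \is a Num.nat.
    by rewrite Cnat_cfdot_char ?cfRes_char ?irr_char.
  by move: ij; rewrite irr_consttE => nz; move/natrP=> [[|n] Dn]; move: nz;
    rewrite Dn ?eqxx // ler1n.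
apply: ler_wpDr; last by rewrite ler_peMr ?char1_ge0 ?irr_char.
apply: sumr_ge0 => k _; rewrite mulr_ge0 ?char1_ge0 ?irr_char //.
by rewrite natr_ge0 // Cnat_cfdot_char ?cfRes_char ?irr_char.
Qed.

Lemma Res_norm_mult_ge0 j : 0 <= a j.
Proof.
apply: sumr_ge0 => k _; rewrite mulr_ge0 ?char1_ge0 ?irr_char //.
by rewrite natr_ge0 // Cnat_cfdot_char ?cfRes_char ?irr_char.
Qed.

Let nsPN : P <| 'N_G(P).
Proof. by rewrite normalSG // (pHall_sub sylP). Qed.

Let nsP'N : P^`(1)%g <| 'N_G(P).
Proof. exact: gFnormal_trans nsPN. Qed.

Lemma Irr_p'_above_norm j : P^`(1)%g \subset cfker 'chi['N_G(P)]_j ->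
  exists2 i, i \in Irr_p' p G & j \in irr_constt ('Res['N_G(P)] 'chi_i).
Proof.
move=> kerj; have sNG: 'N_G(P) \subset G := subsetIl _ _.
apply: Irr_p'_Ind => //.
  have [_ _ p'GP] := and3P sylP; apply: pnat_dvd p'GP.
  exact: indexgS (normal_sub nsPN).
apply: (normal_Sylow_Irr_p' pr_p nsPN _ kerj).
exact: pHall_subl (normal_sub nsPN) sNG sylP.
Qed.

Lemma irr1_le_Res_norm_mult j : P^`(1)%g \subset cfker 'chi['N_G(P)]_j ->
  'chi_j 1%g <= a j.
Proof.
move=> /Irr_p'_above_norm[i p'i ij]; apply: le_trans (Res_norm_mult_ge p'i ij).
by rewrite -(cfRes1 'N_G(P) 'chi_i) char1_ge_constt // cfRes_char ?irr_char.
Qed.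

Let sum_kerP' :
  #|'N_G(P) : P^`(1)|%:R
    = \sum_j (if P^`(1)%g \subset cfker 'chi['N_G(P)]_j
              then 'chi_j 1%g ^+ 2 else 0) :> algC.
Proof. by rewrite -(sum_irr1_sq_quo nsP'N) big_mkcond. Qed.

Let term_le j : true ->
  (if P^`(1)%g \subset cfker 'chi['N_G(P)]_j then 'chi_j 1%g ^+ 2 else 0)
    <= 'chi_j 1%g * a j.
Proof.
move=> _; case: ifP => [/irr1_le_Res_norm_mult le_j | _].
  by rewrite expr2 ler_wpM2l ?char1_ge0 ?irr_char.
by rewrite mulr_ge0 ?Res_norm_mult_ge0 ?char1_ge0 ?irr_char.
Qed.

Lemma sum_Irr_p'_ge :
  #|'N_G(P) : P^`(1)|%:R <= \sum_(i in Irr_p' p G) 'chi[G]_i 1%g ^+ 2 :> algC.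
Proof. by rewrite sum_kerP' sum_Irr_p'_Res ler_sum. Qed.

Hypothesis eq_sum :
  \sum_(i in Irr_p' p G) 'chi[G]_i 1%g ^+ 2 = #|'N_G(P) : P^`(1)|%:R.

Lemma Res_norm_mult_eq j :
  a j = if P^`(1)%g \subset cfker 'chi['N_G(P)]_j then 'chi_j 1%g else 0.
Proof.
have := eq_sum; rewrite sum_Irr_p'_Res sum_kerP' => /esym/eqP.
rewrite (eq_leif (leif_sum (fun j Pj => leif_eq (@term_le j Pj)))).
move/forall_inP/(_ j isT)/eqP; case: ifP => _.
  by rewrite expr2 => /(mulfI (irr1_neq0 j)).
by move/esym/eqP; rewrite mulf_eq0 (negPf (irr1_neq0 j)) => /eqP.
Qed.

(** The multiplicity of a constituent of the restriction of chi_i is at least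
  chi_i(1), so in the case of equality it cannot vanish. *)
Lemma Irr_p'_ker_der i : i \in Irr_p' p G -> P^`(1)%g \subset cfker 'chi[G]_i.
Proof.
move=> p'i; have sP'N := normal_sub nsP'N.
have Ni: 'Res['N_G(P)] 'chi_i \is a character by rewrite cfRes_char ?irr_char.
have: P^`(1)%g \subset cfker ('Res['N_G(P)] 'chi_i).
  rewrite cfkerE // subsetI sP'N; apply/bigcapsP=> j ij.
  have := Res_norm_mult_ge p'i ij; rewrite Res_norm_mult_eq; case: ifP => // _.
  by move/(lt_le_trans (irr1_gt0 i)); rewrite ltxx.
by rewrite cfker_Res ?irr_char ?subsetIl // subsetI => /andP[].
Qed.

(** A character chi_i over chi_j satisfies chi_j(1) <= chi_i(1) <= a j, and in the
  case of equality the two ends agree. *)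
Lemma extend_Irr_p' j : P^`(1)%g \subset cfker 'chi['N_G(P)]_j ->
  exists2 i, i \in Irr_p' p G & 'Res['N_G(P)] 'chi_i = 'chi_j.
Proof.
move=> kerj; have [i p'i ij] := Irr_p'_above_norm kerj; exists i => //.
have := Res_norm_mult_ge p'i ij; rewrite Res_norm_mult_eq kerj => le_ij.
have Ni: 'Res['N_G(P)] 'chi_i \is a character by rewrite cfRes_char ?irr_char.
have [//|psi Npsi Di] := constt_charP _ _ ij.
suff /eqP: psi == 0 by move=> psi0; rewrite Di psi0 addr0.
rewrite -char1_eq0 // eq_le char1_ge0 // andbT.
by move: le_ij; rewrite -(cfRes1 'N_G(P) 'chi_i) Di cfunE gerDl.
Qed.

End Counting.

(** * The common kernel of the characters of degree prime to p *)

Lemma conjg_Iirr_is_action (X : {group gT}) :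
  is_action 'N(X) (fun i y => conjg_Iirr i y : Iirr X).
Proof.
split=> [y | i y z nXy nXz]; first exact: conjg_Iirr_inj.
apply: irr_inj; apply/cfun_inP=> x Xx.
by rewrite !conjg_IirrE !cfConjgE ?groupM // invMg conjgM.
Qed.
Canonical conjg_Iirr_action X := Action (@conjg_Iirr_is_action X).

Section Kernel.

Variables G P : {group gT}.
Hypotheses (pr_p : prime p) (sylP : p.-Sylow(G) P).

Definition Irr_p'_ker := \bigcap_(i in Irr_p' p G) cfker 'chi[G]_i.

Lemma Irr_p'_ker_group_set : group_set Irr_p'_ker.
Proof. exact: group_set_bigcap. Qed.
Canonical Irr_p'_ker_group := Group Irr_p'_ker_group_set.

Lemma Irr0_p' (H : {group gT}) : 0 \in Irr_p' p H.
Proof. by rewrite inE irr0 cfun11 (dvdC_nat p 1) dvdn1 neq_ltn prime_gt1 ?orbT. Qed.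

Lemma Irr_p'_ker_normal : Irr_p'_ker <| G.
Proof.
apply/andP; split.
  by apply: (bigcap_min 0); [apply: Irr0_p' | apply: cfker_sub].
by apply: norms_bigcap; apply/bigcapsP=> i _; apply: cfker_norm.
Qed.

(** The values of xi on the generators are roots of unity of order dividing the
  p'-part of |X|. *)
Lemma p'_gen_cforder (X : {group gT}) (xi : 'CF(X)) :
    X :=: <<[set x in X | p^'.-elt x]>> -> xi \is a linear_char ->
  p^'.-nat #[xi]%CF.
Proof.
move=> genX lin_xi; pose k := (#|X|`_p^')%N.
apply: (@pnat_dvd _ k); last exact: part_pnat.
rewrite dvdn_cforder; have lin_xik := rpredX k lin_xi.
suff: X \subset cfker (xi ^+ k).
  by move=> kerX; rewrite -[_ ^+ k]cfRes_id cfRes_sub_ker // lin_char1 // scale1r.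
rewrite {1}genX gen_subG; apply/subsetP=> x /setIdP[Xx p'x].
rewrite /= cfkerEchar ?lin_charW // inE Xx lin_char1 // exp_cfunE // -lin_charX //.
suff /eqP->: (x ^+ k == 1)%g by rewrite lin_char1 ?eqxx.
rewrite -order_dvdn -[#[x]](part_pnat_id p'x) partn_dvd ?cardG_gt0 //.
exact: order_dvdG.
Qed.

(** Only the trivial character of X can be both invariant under P and of degree
  prime to p: such a character has determinantal order prime to p, hence extends to
  P X, and an extension induced to G has a constituent of degree prime to p, which
  is trivial on X by hypothesis. Counting orbits of P, the sum of the squares of
  the degrees of X, which is |X|, is then congruent to 1 modulo p. *)
Lemma p'_generated_sub_ker_p'group (X : {group gT}) :
    X <| G -> X \subset Irr_p'_ker ->
    X :=: <<[set x in X | p^'.-elt x]>> ->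
  p^'.-group X.
Proof.
move=> nsXG sXK genX; have [sXG nXG] := andP nsXG.
have [sPG pP _] := and3P sylP.
rewrite /pgroup p'natE //; apply/negP=> pX.
have noinv t : t \in Irr_p' p X -> P \subset 'I['chi_t] -> t = 0.
  move=> p't IPt; pose H := (P <*> X)%G.
  have nXP: P \subset 'N(X) by apply: subset_trans nXG.
  have sXH: X \subset H := joing_subr _ _.
  have sPH: P \subset H := joing_subl _ _.
  have nsXH: X <| H by rewrite /normal sXH join_subG nXP normG.
  have sHG: H \subset G by rewrite join_subG sPG.
  have pHX: p.-group (H / X) by rewrite quotientYidr // quotient_pgroup.
  have IHt: H \subset 'I['chi_t] by rewrite join_subG IPt sub_inertia.
  have [||c [Dt _ _]] := extend_solvable_coprime_irr nsXH _ IHt.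
  - exact: pgroup_sol pHX.
  - rewrite -card_quotient ?normal_norm // (pnat_coprime pHX) // pnatM.
    move: p't; rewrite inE irr1_degree natrK dvdC_nat -p'natE // => ->.
    by rewrite andbT p'_gen_cforder ?cfDet_lin_char.
  have p'c: c \in Irr_p' p H by move: p't; rewrite !inE -Dt cfRes1.
  have p'GH: p^'.-nat #|G : H|.
    have [_ _ p'GP] := and3P sylP; apply: pnat_dvd p'GP; exact: indexgS.
  have [i p'i ic] := Irr_p'_Ind pr_p sHG p'GH p'c.
  have kerX: X \subset cfker 'chi_i by apply: subset_trans sXK _; apply: bigcap_inf.
  have kerc: X \subset cfker 'chi_c.
    apply: subset_trans (cfker_constt _ ic); last by rewrite cfRes_char ?irr_char.
    by rewrite cfker_Res ?irr_char // subsetI sXH.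
  apply/eqP; rewrite -subGcfker -Dt cfker_Res ?irr_char // subsetI subxx.
  exact: kerc.
have actS: [acts P, on Irr_p' p X :\ 0 | conjg_Iirr_action X].
  apply/subsetP=> y Py; have nXy := subsetP (subset_trans sPG nXG) y Py.
  rewrite inE nXy inE; apply/subsetP=> t.
  by rewrite !inE /= conjg_Iirr_eq0 conjg_IirrE cfConjg1.
have: (p %| \sum_(t in Irr_p' p X :\ 0) 'chi[X]_t 1%g ^+ 2)%A.
  apply: (dvdA_sum_fixfree pP actS).
  - apply/setP=> t; rewrite !in_setI in_setD1 in_set0.
    apply/negP=> /andP[/andP[/eqP t_nz p't] /afixP fix_t]; case: t_nz.
    apply: noinv => //; apply/subsetP=> y Py; rewrite inE -conjg_IirrE.
    by rewrite (subsetP nXG) ?(subsetP sPG) //=; have /= -> := fix_t y Py.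
  - by move=> y t Py _; rewrite /= conjg_IirrE cfConjg1.
  by move=> t _; rewrite rpredX ?Aint_irr.
(* Split |X| into 1, the nontrivial degrees prime to p, and the others. *)
have := irr_sum_square X; rewrite (bigID (mem (Irr_p' p X))) /=.
rewrite (bigD1 0) ?Irr0_p' //= irr0 cfun11 expr1n.
rewrite (eq_bigl (mem (Irr_p' p X :\ 0))); last first.
  by move=> t; rewrite !inE andbC.
set s1 := \sum_(t in _) _; set s2 := \sum_(t | _) _ => Ds p_s1.
have p_s2: (p %| s2)%A.
  apply: rpred_sum => t; rewrite inE negbK irr1_degree dvdC_nat => p_t.
  rewrite -natrX; suff: (p %| (irr_degree (socle_of_Iirr t) ^ 2)%:R)%A by [].
  by rewrite dvdA_nat dvdn_exp.
have: (p %| (1%N)%:R)%A.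
  have ->: 1%N%:R = #|X|%:R - (s1 + s2) :> algC by rewrite -Ds -(addrA 1) addrK.
  by rewrite rpredB ?rpredD // dvdA_nat.
by rewrite dvdA_nat dvdn1 gtn_eqF ?prime_gt1.
Qed.

(** The subgroup generated by the p'-elements of the common kernel has p-power
  index, and the preceding lemma makes it a p'-group. *)
Lemma Irr_p'_ker_pnilpotent : p.-group (Irr_p'_ker / 'O_p^'(Irr_p'_ker)).
Proof.
set K := Irr_p'_ker_group; pose X := <<[set x in K | p^'.-elt x]>>%G.
have sXK: X \subset K.
  by rewrite gen_subG; apply/subsetP=> x /setIdP[].
have nsXG : X <| G.
  have [sKG nKG] := andP Irr_p'_ker_normal.
  rewrite /normal (subset_trans sXK) // norms_gen //; apply/subsetP=> y Gy.
  rewrite inE; apply/subsetP=> _ /imsetP[x /setIdP[Kx p'x] ->].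
  by rewrite inE p_eltJ p'x andbT memJ_norm // (subsetP nKG).
have genX: X :=: <<[set x in X | p^'.-elt x]>>.
  apply/eqP; rewrite eqEsubset !gen_subG; apply/andP; split.
    by apply: sub_gen; apply/subsetP=> x xK; rewrite inE mem_gen //; case/setIdP: xK.
  by apply/subsetP=> x /setIdP[].
have p'X := p'_generated_sub_ker_p'group nsXG sXK genX.
have sXO: X \subset 'O_p^'(K).
  by rewrite pcore_max // (normalS sXK _ nsXG) // (normal_sub Irr_p'_ker_normal).
apply/pgroupP=> q pr_q /(Cauchy pr_q)[xO KxO oxq]; apply/idPn=> p'q.
case/morphimP: KxO => x nOx Kx Dx.
have p'xO: p^'.-elt xO by rewrite /p_elt oxq pnatE.
have xO1: xO = 1%g.
  rewrite -(constt_p_elt p'xO) Dx -morph_constt //= coset_id //.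
  by rewrite (subsetP sXO) // mem_gen // inE p_elt_constt andbT groupX.
by move: pr_q; rewrite -oxq xO1 order1.
Qed.

End Kernel.

End OneGroup.

Lemma Irr_p'_ker_quo (gT : finGroupType) (p : nat) (G : {group gT}) : prime p ->
  Irr_p'_ker p (G / Irr_p'_ker p G) = 1%g.
Proof.
move=> pr_p; set K := Irr_p'_ker_group p G; apply/trivgP/subsetP=> xK kerx.
have nsKG : K <| G := Irr_p'_ker_normal G pr_p.
have /morphimP[x nKx Gx Dx]: xK \in (G / K)%g.
  by apply: subsetP kerx; rewrite normal_sub ?Irr_p'_ker_normal.
rewrite inE Dx /= coset_id //; apply/bigcapP=> i p'i.
have kerK : K \subset cfker 'chi_i by apply: bigcap_inf.
have /bigcapP/(_ (quo_Iirr K i)) := kerx.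
rewrite inE quo_IirrE // cfQuo1 => /(_ _); move: p'i; rewrite inE => p'i /(_ p'i).
rewrite cfker_quo // Dx => kx.
rewrite -[cfker _](quotientGK (_ : K <| cfker 'chi_i)); last first.
  by rewrite /normal kerK (subset_trans (cfker_sub _)) ?normal_norm.
by apply/morphpreP.
Qed.

(** * Normal p-complements by transfer *)

(** P and its conjugate by y are both Sylow subgroups of the centralizer of x ^ y,
  hence conjugate there; correcting y accordingly moves it into the normalizer of
  P, that is into its centralizer. *)
Lemma Burnside_fusion (gT : finGroupType) (p : nat) (L P : {group gT}) x y :
    p.-Sylow(L) P -> 'N_L(P) \subset 'C(P) ->
  x \in P -> y \in L -> (x ^ y)%g \in P -> (x ^ y = x)%g.
Proof.
move=> sylP cPN Px Ly Pxy; have sPL := pHall_sub sylP.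
have cPP : P \subset 'C(P).
  by apply: subset_trans cPN; rewrite subsetI sPL normG.
have sylC (Q : {group gT}) :
  p.-Sylow(L) Q -> Q \subset 'C[x ^ y] -> p.-Sylow('C_L[x ^ y]) Q.
- by move=> sylQ cQ; apply: (pHall_subl _ (subsetIl _ _) sylQ);
    rewrite subsetI (pHall_sub sylQ).
have sylP1 : p.-Sylow('C_L[x ^ y]) P.
  by apply: sylC; rewrite // sub_cent1 (subsetP cPP).
have sylP2 : p.-Sylow('C_L[x ^ y]) (P :^ y)%G.
  apply: sylC; first by rewrite pHallJ.
  by rewrite cent1J conjSg sub_cent1 (subsetP cPP).
have [c /setIP[Lc cxyc] DP] := Sylow_trans sylP2 sylP1.
have: (y * c)%g \in 'C(P).
  apply: (subsetP cPN); rewrite inE groupM //= inE conjsgM.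
  by rewrite -DP.
move/centP/(_ x Px) => cx.
have : (x ^ (y * c) = x)%g by rewrite conjgE -cx mulKg.
rewrite conjgM => xyc; rewrite -[RHS]xyc [RHS]conjgE.
by rewrite -(cent1P cxyc) mulKg.
Qed.

(** The normal p-complement theorem of Burnside. By the fusion lemma the transfer
  from L to P raises the elements of P to the power |L : P|, which is prime to p;
  its kernel thus meets P trivially and is the complement. *)
Lemma Burnside_pcore (gT : finGroupType) (p : nat) (L P : {group gT}) :
  p.-Sylow(L) P -> 'N_L(P) \subset 'C(P) -> ('O_p^'(L) * P = L)%g.
Proof.
move=> sylP cPN; have [sPL pP p'LP] := and3P sylP.
have abP : abelian (idm P @* P).
  rewrite morphim_idm // /abelian.
  by apply: subset_trans cPN; rewrite subsetI sPL normG.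
pose V := transfer_morphism L abP.
(* The morphism through which P is seen as an additive module. *)
pose F := restrm (transfer_morph_subproof [morphism of idm P])
  (fmod abP \o idm P).
have FX g n : g \in P -> F (g ^+ n)%g = F g *+ n.
  move=> Pg; rewrite /F /restrm /= fmodX //=.
  by rewrite morphim_idm.
have FK g : g \in P -> fmval (F g) = g.
  by move=> Pg; rewrite /F /restrm /=; apply: fmodK; rewrite /= morphim_idm.
have V_P g : g \in P -> V g = F g *+ #|L : P|.
  move=> Pg; have Lg := subsetP sPL g Pg.
  pose X := transversal (rcosets P L :* <[g]>) L.
  have trX : is_transversal X (rcosets P L :* <[g]>) L.
    by apply: transversalP; apply: rcosets_cycle_partition.
  rewrite /= (transfer_cycle_expansion sPL abP Lg trX).
  rewrite -(sum_index_rcosets_cycle sPL Lg trX) -sumrMnr.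
  apply: eq_bigr => x Xx; rewrite -FX //; congr F.
  have Lx := subsetP (transversal_sub trX) x Xx.
  apply: (Burnside_fusion sylP cPN); rewrite ?groupX ?groupV //.
  rewrite conjgE invgK mulgA.
  by have := mulg_exp_card_rcosets P g x; rewrite mem_rcoset.
have tiVP : ('ker V :&: P = 1)%g.
  apply/trivgP/subsetP=> g /setIP[/mker-Vg Pg]; rewrite inE -order_eq1.
  have: (g ^+ #|L : P| == 1)%g.
    by rewrite -{1}(FK g) // -fmvalZ -V_P // Vg.
  rewrite -order_dvdn => /pnat_dvd/(_ p'LP) p'g.
  by apply/eqP; apply: pnat_1 p'g; apply: mem_p_elt pP Pg.
have nsVL : 'ker V <| L := ker_normal V.
have sVO : 'ker V \subset 'O_p^'(L).
  have /pHallP[_ /=] := Sylow_setI_normal nsVL sylP.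
  rewrite tiVP cards1 => oV.
  rewrite pcore_max // /pgroup -[#|_|](partnC p) ?cardG_gt0 //.
  by rewrite -oV mul1n part_pnat.
have oL: (#|'ker V| * #|V @* L| = #|L|)%N.
  by rewrite card_morphim setIid Lagrange ?subsetIl.
have leVP: (#|V @* L| <= #|P|)%N.
  rewrite -(card_imset _ (@fmod_inj _ _ abP)) subset_leq_card //.
  apply/subsetP=> _ /imsetP[u _ ->].
  by have := fmodP u; rewrite /= morphim_idm.
apply/eqP; rewrite eqEcard mul_subG ?pcore_sub //= TI_cardMg; last first.
  apply: coprime_TIg; rewrite coprime_sym.
  exact: pnat_coprime pP (pcore_pgroup _ _).
by rewrite -oL leq_mul ?subset_leq_card.
Qed.

(** * The case of equality *)

(** Here 'O_p^'(D) is a complement to P in D, on which P has no nontrivial fixed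
  point since P is self-normalizing in D; so it lies in the common kernel of the
  characters of G of degree prime to p. *)
Lemma selfnormalizing_abelian_Sylow (gT : finGroupType) (p : nat)
    (G P D : {group gT}) : prime p ->
    p.-Sylow(G) P -> abelian P -> D <| G -> P \subset D ->
    'N_D(P) \subset P -> Irr_p'_ker p G = 1%g ->
  D \subset P.
Proof.
move=> pr_p sylP abP nsDG sPD sNP kerG1; have [sPG pP _] := and3P sylP.
have sylPD : p.-Sylow(D) P := pHall_subl sPD (normal_sub nsDG) sylP.
have defD := Burnside_pcore sylPD (subset_trans sNP abP).
set O := 'O_p^'(D)%G in defD.
have nsOG : O <| G by apply: gFnormal_trans.
have tiOP : (O :&: P = 1)%g.
  apply: coprime_TIg; rewrite coprime_sym.
  exact: pnat_coprime pP (pcore_pgroup _ _).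
have regP : 'C_O(P) = 1%g.
  apply/trivgP; rewrite -tiOP subsetI subsetIl /=; apply: subset_trans sNP.
  by apply: setISS; [apply: pcore_sub | apply: cent_sub].
have O1 : O \subset [1 gT]%g.
  by rewrite -kerG1; apply/bigcapsP=> i; apply: fixfree_sub_cfker pP sPG nsOG regP.
by rewrite -defD (trivgP O1) mul1g.
Qed.

Lemma normal_complement_of_sum_eq (gT : finGroupType) (p : nat)
    (G P : {group gT}) : prime p -> p.-Sylow(G) P ->
    \sum_(i in Irr_p' p G) 'chi[G]_i 1%g ^+ 2 = #|'N_G(P) : P^`(1)|%:R ->
  has_normal_complement 'N_G(P) G.
Proof.
move=> pr_p sylP eq_sum; have [sPG pP _] := and3P sylP.
pose K := Irr_p'_ker_group p G.
have nsKG : K <| G := Irr_p'_ker_normal G pr_p; have [sKG nKG] := andP nsKG.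
have nKP := subset_trans sPG nKG.
have sPN : P \subset 'N_G(P) by rewrite subsetI sPG normG.
have nsPN : P <| 'N_G(P) by rewrite normalSG.
have nsP'N : P^`(1)%g <| 'N_G(P) := gFnormal_trans _ nsPN.
(* Characters of N trivial on P', resp. P, separate its points modulo P', resp. P,
   and extend to G. *)
have tiKN : K :&: 'N_G(P) \subset P^`(1)%g.
  rewrite -(cap_cfker_normal nsP'N); apply/bigcapsP=> j kerj.
  have [i p'i <-] := extend_Irr_p' pr_p sylP eq_sum kerj.
  by rewrite cfker_Res ?subsetIl ?irr_char // setIC setIS // bigcap_inf.
have sP'K : P^`(1)%g \subset K.
  by apply/bigcapsP=> i; apply: Irr_p'_ker_der eq_sum i.
pose D := [group of
  \bigcap_(i in Irr_p' p G | P \subset cfker 'chi[G]_i) cfker 'chi_i].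
have nsDG : D <| G.
  apply/andP; split.
    by apply: (bigcap_min 0); rewrite ?cfker_sub // Irr0_p' // cfker_irr0.
  by apply: norms_bigcap; apply/bigcapsP=> i _; apply: cfker_norm.
have sPD : P \subset D by apply/bigcapsP=> i /andP[].
have sKD : K \subset D.
  by apply/bigcapsP=> i /andP[p'i _]; apply: bigcap_inf.
have tiDN : D :&: 'N_G(P) \subset P.
  have/eqP := cap_cfker_normal nsPN; rewrite eqEsubset => /andP[capP _].
  apply: subset_trans capP; apply/bigcapsP=> j kerj.
  have [i p'i Dj] := extend_Irr_p' pr_p sylP eq_sum (subset_trans (der_sub 1 P) kerj).
  move: kerj; rewrite -Dj cfker_Res ?subsetIl ?irr_char //.
  rewrite subsetI => /andP[_ kerP].
  by rewrite setIC setIS // bigcap_inf ?p'i.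
have sDPK : D \subset (K * P)%g.
  rewrite -quotientSK ?(subset_trans (normal_sub nsDG)) //.
  apply: (@selfnormalizing_abelian_Sylow _ p (G / K)%G (P / K)%G (D / K)%G).
  - exact: pr_p.
  - exact: quotient_pHall.
  - exact: sub_der1_abelian.
  - exact: quotient_normal.
  - exact: quotientS.
  - rewrite /= -(quotientYidr nKP) -quotient_subnormG; last first.
      by rewrite /normal joing_subr join_subG normG nKP.
    rewrite quotientS //.
    (* An element normalizing P K is, up to a factor in P K, in the normalizer of P. *)
    have nsPK : (P <*> K) <| 'N_D(P <*> K).
      by rewrite normalSG // join_subG sPD.
    have sylPK : p.-Sylow(P <*> K) P.
      apply: pHall_subl sylP; first exact: joing_subl.
      by rewrite join_subG sPG.
    rewrite -(Frattini_arg nsPK sylPK) mul_subG //.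
    apply: subset_trans (joing_subl P K); apply: subset_trans tiDN.
    by rewrite setIA (setIidPl (normal_sub nsDG)) setSI ?subsetIl.
  exact: Irr_p'_ker_quo.
have defG : G \subset (K * 'N_G(P))%g.
  rewrite -{1}(Frattini_arg nsDG (pHall_subl sPD (normal_sub nsDG) sylP)).
  apply: subset_trans (mulSg _ sDPK) _.
  by rewrite -mulgA mulgS // mul_subG.
pose X := 'O_p^'(K)%G; have nsXK : X <| K := pcore_normal _ _.
have nsXG : X <| G := gFnormal_trans _ nsKG.
have defK : K \subset (X * (K :&: P))%g.
  have sylKP := Sylow_setI_normal nsKG sylP.
  rewrite -quotientSK ?normal_norm //.
  have sylKPX := quotient_pHall (subset_trans (subsetIl _ _) (normal_norm nsXK)) sylKP.
  by rewrite -(pHall_id sylKPX (Irr_p'_ker_pnilpotent pr_p sylP)).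
exists X => //; apply/complP; split.
  apply/trivgP; rewrite -(@coprime_TIg _ P X); last first.
    exact: pnat_coprime pP (pcore_pgroup _ _).
  rewrite subsetI subsetIr andbT; apply: subset_trans (der_sub 1 P).
  by apply: subset_trans tiKN; rewrite (setIC K) setIS // normal_sub.
apply/eqP; rewrite eqEsubset mul_subG ?subsetIl ?(normal_sub nsXG) //=.
rewrite normC; last exact: subset_trans (subsetIl _ _) (normal_norm nsXG).
apply: (subset_trans defG); apply: subset_trans (mulSg _ defK) _.
by rewrite -mulgA mulgS // mul_subG // subIset // sPN orbT.
Qed.

Lemma sum_eq_of_normal_complement (gT : finGroupType) (p : nat)
    (G P : {group gT}) : prime p -> p.-Sylow(G) P ->
    has_normal_complement 'N_G(P) G ->
  \sum_(i in Irr_p' p G) 'chi[G]_i 1%g ^+ 2 = #|'N_G(P) : P^`(1)|%:R.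
Proof.
move=> pr_p sylP [M nsMG /complP[tiNM defG]]; have [sPG pP _] := and3P sylP.
have [sMG nMG] := andP nsMG; have nMP := subset_trans sPG nMG.
have sPN : P \subset 'N_G(P) by rewrite subsetI sPG normG.
have nsPN : P <| 'N_G(P) by rewrite normalSG.
have nsP'N : P^`(1)%g <| 'N_G(P) := gFnormal_trans _ nsPN.
have sP'P := der_sub 1 P.
have regP : 'C_M(P) = 1%g.
  by apply/trivgP; rewrite -tiNM subsetI subsetIl setISS ?cent_sub.
have defGM : ('N_G(P) / M = G / M)%g by rewrite -[in RHS]defG quotientMidr.
(* P' is dealt with in G / M, where the image of P is normal. *)
have nsV i : i \in Irr_p' p G -> M <*> P^`(1)%g \subset cfker 'chi_i.
  move=> p'i; have kerM := fixfree_sub_cfker pP sPG nsMG regP p'i.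
  rewrite join_subG kerM -(quotientSGK _ kerM) ?(subset_trans sP'P) //.
  rewrite quotient_der // -cfker_quo // -quo_IirrE //.
  apply: normal_pgroup_der_sub_cfker.
  - exact: quotient_pgroup pP.
  - by rewrite /= -defGM quotient_normal.
  by rewrite inE quo_IirrE // cfQuo1; move: p'i; rewrite inE.
have nMP' : P^`(1)%g \subset 'N(M) by apply: subset_trans nMP.
have nsVG : M <*> P^`(1)%g <| G.
  rewrite /normal join_subG sMG (subset_trans sP'P) //= -{1}defG mul_subG //.
    by rewrite normsY ?(normal_norm nsP'N) // (subset_trans (subsetIl _ _)).
  by rewrite (subset_trans (joing_subl M P^`(1)%g)) ?normG.
have iV : #|G : M <*> P^`(1)%g| = #|'N_G(P) : P^`(1)%g|.
  have tiP'M : P^`(1)%g :&: M = 1%g.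
    by apply/trivgP; rewrite -tiNM setSI // normal_sub.
  apply/eqP; rewrite -(eqn_pmul2l (cardG_gt0 (M <*> P^`(1)))) Lagrange ?normal_sub //.
  rewrite /= joingC norm_joinEl // TI_cardMg // mulnAC Lagrange ?normal_sub //.
  by rewrite -TI_cardMg // defG.
apply/le_anti; rewrite sum_Irr_p'_ge // andbT -iV -(sum_irr1_sq_quo nsVG).
rewrite big_mkcond [leRHS]big_mkcond; apply: ler_sum => i _.
case: ifP => [/nsV -> // | _]; case: ifP => // _.
by rewrite exprn_ge0 // char1_ge0 ?irr_char.
Qed.

Theorem theoremB (gT : finGroupType) (G P : {group gT})
    (sylP : 2%N.-Sylow(G) P) :
  #|'N_G(P) : P^`(1)|%:R <= \sum_(i in Irr_odd G) 'chi[G]_i 1%g ^+ 2 :> algC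
  /\ (\sum_(i in Irr_odd G) 'chi[G]_i 1%g ^+ 2 = #|'N_G(P) : P^`(1)|%:R
      <-> has_normal_complement 'N_G(P) G).
Proof.
have ->: Irr_odd G = Irr_p' 2 G.
  by apply/setP=> i; rewrite !inE irr1_degree natrK dvdC_nat dvdn2 negbK.
split; first exact: sum_Irr_p'_ge.
by split; [apply: normal_complement_of_sum_eq | apply: sum_eq_of_normal_complement].
Qed.
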